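(* Let $A$ be a commutative ring, $d,r\ge 0$ integers, $M$ a finitely generated $A$-module and $\mathfrak J$ the annihilator of $M$. If the Krull dimension of $A/\mathfrak J$ is $\le d$ and $M$ is locally generated by $r$ elements, then $M$ can be generated by $d+r$ elements.
   Context: A finitely generated module $M$ is locally generated by $r$ elements if there are $s_1,\dots,s_n\in A$ generating the unit ideal such that each $M[s_i^{-1}]$ is generated by $r$ elements over $A[s_i^{-1}]$ (classically: $M_{\mathfrak p}$ is generated by $r$ elements for every prime $\mathfrak p$). No noetherian hypothesis is made. *)

(* Defs.v *)
From HB Require Import structures.
From mathcomp Require Import all_boot all_order all_algebra.
From mathcomp Require Import boolp classical_sets.
From mathcomp Require Import zify.

Set Implicit Arguments.
Unset Strict Implicit.
Unset Printing Implicit Defensive.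

Import GRing.Theory.

Local Open Scope classical_set_scope.
Local Open Scope quotient_scope.
Local Open Scope ring_scope.

(* Rings are [comPzRingType] rather than [comNzRingType] throughout: the zero
   ring must be allowed, since the quotient by the annihilator of the zero
   module, and the localization at a nilpotent element, are zero rings. *)

(* ring_quotient.v's [idealr] only covers proper ideals of nonzero rings, while the
   annihilator of the zero module is the unit ideal. *)
HB.mixin Record isAbsorbing (R : comPzRingType) (S : R -> bool) := {
  absorbing_subproof : forall a, {in S, forall u, a * u \in S}
}.

#[short(type="ideal")]
HB.structure Definition Ideal (R : comPzRingType) :=
  {S of GRing.ZmodClosed R S & isAbsorbing R S}.

(* ring_quotient.v gives [{ideal_quot I}] the structure of an additive group for
   every additive subgroup [I], but a product only when [I] is proper. *)
Section QuotientRing.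
Variables (R : comPzRingType) (I : ideal R).

Definition quotient_ring := {ideal_quot I}.

HB.instance Definition _ := GRing.Zmodule.on quotient_ring.

Definition quot_proj (x : R) : quotient_ring := \pi_({ideal_quot I}) x.
Definition quot_repr (x : quotient_ring) : R := repr (x : {ideal_quot I}).

Lemma quot_eqP (x y : R) : reflect (quot_proj x = quot_proj y) (x - y \in I).
Proof. by rewrite Quotient.idealrBE; apply: eqP. Qed.

Lemma quot_reprK : cancel quot_repr quot_proj.
Proof. by move=> x; apply: reprK. Qed.

Lemma quot_ind (P : quotient_ring -> Prop) :
  (forall x, P (quot_proj x)) -> forall x, P x.
Proof. by move=> h x; rewrite -[x]quot_reprK. Qed.

Lemma quot_projB : {morph quot_proj : x y / x - y}.
Proof. by move=> x y; rewrite /quot_proj !piE. Qed.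

Definition quot_one : quotient_ring := quot_proj 1.
Definition quot_mul (x y : quotient_ring) : quotient_ring :=
  quot_proj (quot_repr x * quot_repr y).

Lemma quot_mulE (x y : R) :
  quot_mul (quot_proj x) (quot_proj y) = quot_proj (x * y).
Proof.
have E z : quot_repr (quot_proj z) - z \in I by apply/quot_eqP; rewrite quot_reprK.
apply/quot_eqP; set x' := quot_repr _; set y' := quot_repr _.
have -> : x' * y' - x * y = y' * (x' - x) + x * (y' - y).
  by rewrite !mulrBr [y' * x']mulrC [y' * x]mulrC addrA subrK.
by rewrite rpredD //; apply: absorbing_subproof; apply: E.
Qed.

Lemma quot_mulA : associative quot_mul.
Proof. by do 3!elim/quot_ind => ?; rewrite !quot_mulE mulrA. Qed.

Lemma quot_mulC : commutative quot_mul.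
Proof. by do 2!elim/quot_ind => ?; rewrite !quot_mulE mulrC. Qed.

Lemma quot_mul1 : left_id quot_one quot_mul.
Proof. by elim/quot_ind => ?; rewrite quot_mulE mul1r. Qed.

Lemma quot_projD : {morph quot_proj : x y / x + y}.
Proof. by move=> x y; rewrite /quot_proj !piE. Qed.

Lemma quot_mulDl : left_distributive quot_mul +%R.
Proof.
elim/quot_ind => x; elim/quot_ind => y; elim/quot_ind => z.
by rewrite -quot_projD !quot_mulE -quot_projD mulrDl.
Qed.

HB.instance Definition _ := GRing.Zmodule_isComPzRing.Build quotient_ring
  quot_mulA quot_mulC quot_mul1 quot_mulDl.

HB.instance Definition _ :=
  GRing.isZmodMorphism.Build R quotient_ring quot_proj quot_projB.

Lemma quot_proj_is_monoid_morphism : monoid_morphism quot_proj.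
Proof. by split=> // x y; rewrite -quot_mulE. Qed.

HB.instance Definition _ := GRing.isMonoidMorphism.Build R quotient_ring
  quot_proj quot_proj_is_monoid_morphism.

End QuotientRing.

Section Annihilator.
Variables (A : comPzRingType) (M : lmodType A).

Definition annihilator : {pred A} :=
  fun a => `[< forall m : M, a *: m = 0 >].

Lemma annihilator_zmod_closed : zmod_closed annihilator.
Proof.
split=> [|a b /asboolP ha /asboolP hb]; apply/asboolP => m.
  by rewrite scale0r.
by rewrite scalerBl ha hb subr0.
Qed.

HB.instance Definition _ :=
  GRing.isZmodClosed.Build A annihilator annihilator_zmod_closed.

Lemma annihilator_absorbing a : {in annihilator, forall u, a * u \in annihilator}.
Proof. by move=> u /asboolP hu; apply/asboolP => m; rewrite -scalerA hu scaler0. Qed.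

HB.instance Definition _ := isAbsorbing.Build A annihilator annihilator_absorbing.

End Annihilator.

Section KrullDimension.
Variable R : comPzRingType.

Definition prime_ideal (P : set R) : Prop :=
  [/\ P 0, forall x y, P x -> P y -> P (x + y), forall a x, P x -> P (a * x),
      ~ P 1 & forall x y, P (x * y) -> P x \/ P y].

(* A chain P_0 < ... < P_n of n + 1 primes has length n. The zero ring has no
   prime, hence dimension <= d for every d. *)
Definition krull_dim_le (d : nat) : Prop :=
  forall (n : nat) (P : 'I_n.+1 -> set R),
    (forall i, prime_ideal (P i)) ->
    (forall i j : 'I_n.+1, (i < j)%N -> P i `<` P j) ->
    (n <= d)%N.

End KrullDimension.

Section Localization.
Variables (A : comPzRingType) (s : A).

Section Group.
Variable V : lmodType A.

(* The pair (m, i) represents the fraction m / s ^ i. *)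
Definition frac_equiv (x y : V * nat) : bool :=
  `[< exists k, s ^+ (k + y.2) *: x.1 = s ^+ (k + x.2) *: y.1 >].

Lemma frac_equiv_is_equiv : equiv_class_of frac_equiv.
Proof.
split=> [x|x y|y x z].
- by apply/asboolP; exists 0%N.
- by apply/asboolP/asboolP => -[k e]; exists k.
- move=> /asboolP[k e] /asboolP[l f]; apply/asboolP.
  exists (k + l + y.2)%N.
  have -> : (k + l + y.2 + z.2 = (l + z.2) + (k + y.2))%N by lia.
  have -> : (k + l + y.2 + x.2 = (k + x.2) + (l + y.2))%N by lia.
  by rewrite exprD -scalerA e scalerA mulrC -scalerA f scalerA -exprD.
Qed.

Canonical frac_equiv_equiv := EquivRelPack frac_equiv_is_equiv.
Canonical frac_equiv_encModRel := defaultEncModRel frac_equiv.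

Definition localization := {eq_quot frac_equiv}.

HB.instance Definition _ := Choice.on localization.

Definition lfrac (m : V) (i : nat) : localization :=
  \pi_({eq_quot frac_equiv}) (m, i).

Definition lfrac_num (x : localization) : V :=
  (repr (x : {eq_quot frac_equiv})).1.
Definition lfrac_exp (x : localization) : nat :=
  (repr (x : {eq_quot frac_equiv})).2.

Lemma lfrac_eqP (m n : V) (i j : nat) :
  lfrac m i = lfrac n j <-> exists k, s ^+ (k + j) *: m = s ^+ (k + i) *: n.
Proof.
split=> [/eqmodP/asboolP //|h].
by apply/eqmodP/asboolP.
Qed.

Lemma lfracK (x : localization) : lfrac (lfrac_num x) (lfrac_exp x) = x.
Proof. by rewrite /lfrac -surjective_pairing reprK. Qed.

Lemma lfracW (P : localization -> Prop) :
  (forall m i, P (lfrac m i)) -> forall x, P x.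
Proof. by move=> h x; rewrite -[x]lfracK. Qed.

Definition loc_zero : localization := lfrac 0 0.
Definition loc_opp (x : localization) : localization :=
  lfrac (- lfrac_num x) (lfrac_exp x).
Definition loc_add (x y : localization) : localization :=
  lfrac (s ^+ lfrac_exp y *: lfrac_num x + s ^+ lfrac_exp x *: lfrac_num y)
       (lfrac_exp x + lfrac_exp y).

Lemma loc_oppE m i : loc_opp (lfrac m i) = lfrac (- m) i.
Proof.
have /lfrac_eqP[k e] := lfracK (lfrac m i).
by apply/lfrac_eqP; exists k; rewrite !scalerN e.
Qed.

Lemma loc_addE m i n j :
  loc_add (lfrac m i) (lfrac n j) = lfrac (s ^+ j *: m + s ^+ i *: n) (i + j).
Proof.
have /lfrac_eqP[k e] := lfracK (lfrac m i); have /lfrac_eqP[l f] := lfracK (lfrac n j).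
rewrite /loc_add; move: (lfrac_num _) (lfrac_exp _) e => m' i' e.
move: (lfrac_num _) (lfrac_exp _) f => n' j' f.
apply/lfrac_eqP; exists (k + l)%N; rewrite !scalerDr !scalerA -!exprD.
congr (_ + _).
- have -> : (k + l + (i + j) + j' = (l + j + j') + (k + i))%N by lia.
  have -> : (k + l + (i' + j') + j = (l + j + j') + (k + i'))%N by lia.
  by rewrite ![s ^+ (l + j + j' + _)]exprD -!scalerA e.
- have -> : (k + l + (i + j) + i' = (k + i + i') + (l + j))%N by lia.
  have -> : (k + l + (i' + j') + i = (k + i + i') + (l + j'))%N by lia.
  by rewrite ![s ^+ (k + i + i' + _)]exprD -!scalerA f.
Qed.

Lemma loc_addA : associative loc_add.
Proof.
elim/lfracW => m i; elim/lfracW => n j; elim/lfracW => p k; rewrite !loc_addE.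
rewrite !scalerDr !scalerA -!exprD !addrA !addnA.
by rewrite [(k + j)%N]addnC [(k + i)%N]addnC.
Qed.

Lemma loc_addC : commutative loc_add.
Proof.
by elim/lfracW => m i; elim/lfracW => n j; rewrite !loc_addE addrC addnC.
Qed.

Lemma loc_add0 : left_id loc_zero loc_add.
Proof.
by elim/lfracW => m i; rewrite loc_addE scaler0 add0r expr0 scale1r.
Qed.

Lemma loc_addN : left_inverse loc_zero loc_opp loc_add.
Proof.
elim/lfracW => m i; rewrite loc_oppE loc_addE scalerN addNr.
by apply/lfrac_eqP; exists 0%N; rewrite !scaler0.
Qed.

HB.instance Definition _ :=
  GRing.isZmodule.Build localization loc_addA loc_addC loc_add0 loc_addN.

Lemma lfracD m i n j :
  lfrac m i + lfrac n j = lfrac (s ^+ j *: m + s ^+ i *: n) (i + j).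
Proof. exact: loc_addE. Qed.

Lemma lfracMexp k m i : lfrac (s ^+ k *: m) (k + i) = lfrac m i.
Proof.
by apply/lfrac_eqP; exists 0%N; rewrite !add0n scalerA -exprD addnC.
Qed.

Lemma lfracDe m n i : lfrac m i + lfrac n i = lfrac (m + n) i.
Proof. by rewrite lfracD -scalerDr lfracMexp. Qed.

End Group.

Definition localization_ring := localization A^o.

HB.instance Definition _ := GRing.Zmodule.on localization_ring.

Definition ring_frac (a : A) (i : nat) : localization_ring := lfrac (a : A^o) i.

Lemma ring_fracW (P : localization_ring -> Prop) :
  (forall a i, P (ring_frac a i)) -> forall x, P x.
Proof. by move=> h; apply: (@lfracW A^o) => a i; apply: h. Qed.

Definition loc_scale (V : lmodType A) (a : localization_ring)
    (x : localization V) : localization V :=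
  lfrac ((lfrac_num a : A) *: lfrac_num x) (lfrac_exp a + lfrac_exp x).

Lemma loc_scaleE (V : lmodType A) (a : A) (i : nat) (m : V) (j : nat) :
  loc_scale (ring_frac a i) (lfrac m j) = lfrac (a *: m) (i + j).
Proof.
have /lfrac_eqP[k e] := lfracK (lfrac (a : A^o) i).
have /lfrac_eqP[l f] := lfracK (lfrac m j).
rewrite /loc_scale; move: (lfrac_num _) (lfrac_exp _) e => a' i' e.
move: (lfrac_num _) (lfrac_exp _) f => m' j' f.
have {}e : s ^+ (k + i) * (a' : A) = s ^+ (k + i') * a by exact: e.
apply/lfrac_eqP; exists (k + l)%N.
have -> : (k + l + (i + j) = (k + i) + (l + j))%N by lia.
have -> : (k + l + (i' + j') = (k + i') + (l + j'))%N by lia.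
by rewrite scalerA exprD mulrAC -scalerA f e scalerA mulrAC -exprD -scalerA.
Qed.

Definition loc_one : localization_ring := ring_frac 1 0.
Definition loc_mul (a b : localization_ring) : localization_ring :=
  loc_scale a b.

Lemma loc_mulE (a b : A) (i j : nat) :
  loc_mul (ring_frac a i) (ring_frac b j) = ring_frac (a * b) (i + j).
Proof. exact: loc_scaleE. Qed.

Lemma ring_fracDe (a b : A) (i : nat) :
  ring_frac a i + ring_frac b i = ring_frac (a + b) i.
Proof. exact: lfracDe. Qed.

Lemma ring_fracMexp k (a : A) i : ring_frac (s ^+ k * a) (k + i) = ring_frac a i.
Proof. exact: lfracMexp. Qed.

Lemma loc_scaleA (V : lmodType A) (a b : localization_ring)
    (x : localization V) :
  loc_scale a (loc_scale b x) = loc_scale (loc_mul a b) x.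
Proof.
move: a b x; elim/ring_fracW => a i; elim/ring_fracW => b j.
by elim/lfracW => m k; rewrite loc_mulE !loc_scaleE scalerA addnA.
Qed.

Lemma loc_scale1 (V : lmodType A) : left_id loc_one (@loc_scale V).
Proof. by elim/lfracW => m i; rewrite loc_scaleE scale1r. Qed.

Lemma loc_scaleDr (V : lmodType A) : right_distributive (@loc_scale V) +%R.
Proof.
elim/ring_fracW => a i; elim/lfracW => m j; elim/lfracW => n k.
rewrite -(lfracMexp k m j) -(lfracMexp j n k) [(j + k)%N]addnC.
by rewrite lfracDe !loc_scaleE lfracDe scalerDr.
Qed.

Lemma loc_scaleDl (V : lmodType A) (x : localization V) :
  {morph (@loc_scale V)^~ x : a b / a + b}.
Proof.
move: x; elim/lfracW => m i; elim/ring_fracW => a j; elim/ring_fracW => b k.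
rewrite -(ring_fracMexp k a j) -(ring_fracMexp j b k) [(j + k)%N]addnC.
by rewrite ring_fracDe !loc_scaleE lfracDe scalerDl.
Qed.

Lemma loc_mulC : commutative loc_mul.
Proof.
by elim/ring_fracW => a i; elim/ring_fracW => b j; rewrite !loc_mulE mulrC addnC.
Qed.

Lemma loc_mulDl : left_distributive loc_mul +%R.
Proof. by move=> a b c; apply: loc_scaleDl. Qed.

HB.instance Definition _ := GRing.Zmodule_isComPzRing.Build localization_ring
  (@loc_scaleA A^o) loc_mulC (@loc_scale1 A^o) loc_mulDl.

HB.instance Definition _ (V : lmodType A) :=
  GRing.Zmodule_isLmodule.Build localization_ring (localization V)
    (@loc_scaleA V) (@loc_scale1 V) (@loc_scaleDr V) (@loc_scaleDl V).

End Localization.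

Section Generators.
Variables (R : pzRingType) (V : lmodType R).

Definition generated_by (n : nat) : Prop :=
  exists v : 'I_n -> V,
    forall m, exists c : 'I_n -> R, m = \sum_(i < n) c i *: v i.

Definition finitely_generated : Prop := exists n, generated_by n.

End Generators.

Definition locally_generated_by (A : comPzRingType) (M : lmodType A)
    (r : nat) : Prop :=
  exists (n : nat) (s : 'I_n -> A),
    (exists c : 'I_n -> A, \sum_(i < n) c i * s i = 1) /\
    (forall i : 'I_n, @generated_by (localization_ring (s i))
                        (localization (s i) M) r).

(* Main.v *)
Require Import Defs.
From mathcomp Require Import all_boot all_order all_algebra.
From mathcomp Require Import boolp classical_sets.
From mathcomp Require Import zify ring.

Set Implicit Arguments.
Unset Strict Implicit.
Unset Printing Implicit Defensive.

Import GRing.Theory.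

Local Open Scope classical_set_scope.
Local Open Scope ring_scope.

(** Let g_0, ..., g_k generate M, with k + 1 > d + r, and put n = k + 1 - r, so
    that n > d.  It suffices to find t with M generated by the k elements
    g_i - t_i g_0 (i > 0), and then to repeat.  Written in the generators g_0 and
    g_i - t_i g_0, a relation sum_i a_i g_i = 0 has the coefficient
    a_0 + sum_i t_i a_i at g_0 ([coef0]); these coefficients form an ideal D_t
    that contains J = ann M, and g_0 is redundant as soon as 1 belongs to D_t.

    Two facts make D_t the unit ideal for a suitable t.

    - Locally generated by r elements means that the coordinates a_0 of the
      relations and the n x n minors of matrices of relations generate the unit
      ideal.  Over A[1/s], substituting the generators g in r others and back gives
      relations s^N - Q P with Q P of rank at most r, and det (G + Q P) lies in the
      ideal of (m - r)-minors of the m x m matrix G ([det_add_low_rank]).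

    - Let delta be a minor, taken on the relations R_1, ..., R_n, that does not
      use coordinate 0.  Replacing t by t + delta * adj * X changes the n
      numbers c_j = coef0 t R_j into c_j + delta^2 X_j, by Cramer's rule.  Since
      dim A/J < n, Kronecker's theorem ([kronecker]) gives an X for which delta
      belongs to the radical of J + (c_j + delta^2 X_j), hence to the radical of
      the new D_t; modulo delta nothing has changed, so D_t only grows up to
      radical ([absorbed_minor]).  The elements that can be absorbed like this form
      an ideal ([absorbed_ideal]), so 1 can be absorbed.

    The theorem of Kronecker is proved by induction on the dimension: dividing
    by the boundary ideal (x) + (rad I : x) lowers the dimension, because no prime
    that contains it is minimal over I ([dim_lt_boundary]).

    Radicals of ideals only occur through the primes that contain an ideal, whose
    existence comes from Zorn's lemma ([prime_avoiding]). *)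

(** * Ideals and the existence of primes *)
Section Ideals.
Variable A : comPzRingType.
Implicit Types (I J K P Q U S : set A) (a b c x y z : A).

(** Ideals are plain sets, like the primes, since most of those below are
    defined by a condition quantified over primes. *)
Definition is_ideal S : Prop :=
  [/\ S 0, forall x y, S x -> S y -> S (x + y) & forall a x, S x -> S (a * x)].

Lemma prime_is_ideal P : prime_ideal P -> is_ideal P.
Proof. by case. Qed.

Lemma prime_exp P x k : prime_ideal P -> P (x ^+ k) -> P x.
Proof.
case=> _ _ _ P1 PM; elim: k => [|k IH]; first by rewrite expr0 => /P1.
by rewrite exprS => /PM[].
Qed.

Lemma ideal_sum S (T : finType) (F : T -> A) :
  is_ideal S -> (forall i, S (F i)) -> S (\sum_i F i).
Proof. by case=> S0 SD _ SF; elim/big_ind: _. Qed.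

Lemma ideal_subD S x y : is_ideal S -> S y -> S (x + y) -> S x.
Proof.
case=> _ SD SM Sy /SD h; suff: S (x + y + (-1) * y) by rewrite mulN1r addrK.
by apply/h/SM.
Qed.

(** The ideal S + (w_1, ..., w_n). *)
Definition adjoin S n (w : 'I_n -> A) : set A :=
  [set z | exists b u, S b /\ z = b + \sum_(i < n) u i * w i].

Lemma adjoin_ideal S n (w : 'I_n -> A) : is_ideal S -> is_ideal (adjoin S w).
Proof.
case=> S0 SD SM; split.
- exists 0, (fun=> 0); split=> //; rewrite big1 ?addr0 // => i _.
  by rewrite mul0r.
- move=> _ _ [b [u [Sb ->]]] [c [v [Sc ->]]].
  exists (b + c), (fun i => u i + v i); split; first exact: SD.
  by rewrite addrACA -big_split /=; under [in RHS]eq_bigr do rewrite mulrDl.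
- move=> a _ [b [u [Sb ->]]]; exists (a * b), (fun i => a * u i).
  split; first exact: SM.
  by rewrite mulrDr mulr_sumr; under eq_bigr do rewrite mulrA.
Qed.

Lemma sub_adjoin S n (w : 'I_n -> A) : S `<=` adjoin S w.
Proof.
move=> x Sx; exists x, (fun=> 0); split=> //.
by rewrite big1 ?addr0 // => i _; rewrite mul0r.
Qed.

Lemma adjoin_gen S n (w : 'I_n -> A) i : S 0 -> adjoin S w (w i).
Proof.
move=> S0; exists 0, (fun j => (j == i)%:R); split=> //.
rewrite add0r (bigD1 i) //= eqxx mul1r big1 ?addr0 // => j /negPf->.
by rewrite mul0r.
Qed.

Definition adjoin1 S x : set A := adjoin S (fun _ : 'I_1 => x).

Lemma adjoin1P S x z :
  adjoin1 S x z <-> exists b a, S b /\ z = b + a * x.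
Proof.
split=> [[b [u [Sb ->]]]|[b [a [Sb ->]]]].
  by exists b, (u ord0); rewrite big_ord1.
by exists b, (fun=> a); rewrite big_ord1.
Qed.

(** An ideal maximal among those disjoint from the multiplicative set U is prime:
    if x and y lie outside it, both P + (x) and P + (y) meet U, and so does the
    product of the two, which is contained in P + (x y). *)
Lemma prime_avoiding I U : is_ideal I -> U 1 ->
  (forall x y, U x -> U y -> U (x * y)) -> (forall x, I x -> ~ U x) ->
  exists P, [/\ prime_ideal P, I `<=` P & forall x, P x -> ~ U x].
Proof.
move=> idI U1 UM IU; have [I0 ID IM] := idI.
pose good := [set X | is_ideal (X `|` I) /\ forall x, (X `|` I) x -> ~ U x].
have [F goodF chF|X [[idX XU] maxX]] := Zorn_bigcup (P := good).
  (* Adjoining I to each member makes the empty chain harmless. *)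
  have common x y : ((\bigcup_(X in F) X) `|` I) x ->
      ((\bigcup_(X in F) X) `|` I) y ->
      (I x /\ I y) \/ exists2 X, F X & (X `|` I) x /\ (X `|` I) y.
    move=> [[X FX Xx]|Ix] [[Y FY Yy]|Iy].
    - have [XY|YX] := chF _ _ FX FY; right.
        by exists Y => //; split; left=> //; apply: XY.
      by exists X => //; split; left=> //; apply: YX.
    - by right; exists X => //; split; [left|right].
    - by right; exists Y => //; split; [right|left].
    - by left.
  have up X : F X -> (X `|` I) `<=` ((\bigcup_(X in F) X) `|` I).
    by move=> FX x [Xx|Ix]; [left; exists X|right].
  split; [split|].
  - by right.
  - move=> x y hx hy; have [[Ix Iy]|[X FX [Xx Xy]]] := common _ _ hx hy.
      by right; apply: ID.
    by have [[_ XD _] _] := goodF _ FX; apply: (up X FX); apply: XD.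
  - move=> a x hx; have [[Ix _]|[X FX [Xx _]]] := common _ _ hx hx.
      by right; apply: IM.
    by have [[_ _ XM] _] := goodF _ FX; apply: (up X FX); apply: XM.
  - move=> x hx; have [[Ix _]|[X FX [Xx _]]] := common _ _ hx hx.
      exact: IU.
    by have [_ XU] := goodF _ FX; apply: XU.
set P := X `|` I in idX XU; exists P; have [P0 PD PM] := idX.
have IP : I `<=` P by right.
have meets x : ~ P x -> exists b a, P b /\ U (b + a * x).
  move=> Px; apply: contrapT => noU; apply: (maxX (adjoin1 P x)).
    split; first by move=> y Xy; apply: sub_adjoin; left.
    by move/(_ x (adjoin_gen _ ord0 P0)) => Xx; apply: Px; left.
  have adjI : adjoin1 P x `|` I = adjoin1 P x.
    by apply/setUidPl => y Iy; apply/sub_adjoin/IP.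
  rewrite /good /mkset adjI; split; first exact: adjoin_ideal.
  by move=> z /adjoin1P[b [a [Pb ->]]] Uz; apply: noU; exists b, a.
split=> //; split=> //; first by move/XU.
move=> x y Pxy; apply: contrapT => /not_orP[/meets[b [a [Pb Ux]]]].
move=> /meets[c [e [Pc Uy]]]; apply: XU (UM _ _ Ux Uy).
rewrite (_ : _ * _ = (c + e * y) * b + (a * x) * c + (a * e) * (x * y)); last by ring.
by apply: (PD); [apply: PD|]; apply: PM.
Qed.

Lemma prime_avoiding_exp I a : is_ideal I -> (forall k, ~ I (a ^+ k)) ->
  exists P, [/\ prime_ideal P, I `<=` P & ~ P a].
Proof.
move=> idI Ia.
have [|||P [pP IP PU]] :=
    @prime_avoiding I [set x | exists k, x = a ^+ k] idI.
- by exists 0%N.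
- by move=> _ _ [k ->] [l ->]; exists (k + l)%N; rewrite exprD.
- by move=> x Ix [k xE]; apply: (Ia k); rewrite -xE.
by exists P; split=> // Pa; apply: PU Pa _; exists 1%N.
Qed.

Lemma ideal_unit I : is_ideal I ->
  (forall P, prime_ideal P -> I `<=` P -> False) -> I 1.
Proof.
move=> idI noP; apply: contrapT => I1.
have [k|P [pP IP _]] := @prime_avoiding_exp I 1 idI; first by rewrite expr1n.
exact: noP pP IP.
Qed.

(** * Krull dimension and the theorem of Kronecker *)

(** The condition dim A/I < n, on chains of primes of A above I.  The strict form
    starts at n = 0, which says that no prime contains I. *)
Definition dim_lt I (n : nat) : Prop :=
  forall (m : nat) (P : 'I_m.+1 -> set A),
    (forall i, prime_ideal (P i) /\ I `<=` P i) ->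
    (forall i j : 'I_m.+1, (i < j)%N -> P i `<` P j) ->
    (m < n)%N.

Lemma dim_ltW I m n : (m <= n)%N -> dim_lt I m -> dim_lt I n.
Proof. by move=> mn dI k P pP sP; apply: leq_trans mn; apply: dI sP. Qed.

(** The ideal (rad I : x). *)
Definition colon_rad I x : set A :=
  [set c | forall P, prime_ideal P -> I `<=` P -> P (c * x)].

Lemma colon_rad_ideal I x : is_ideal (colon_rad I x).
Proof.
split=> [P [P0 _ _ _ _] _|c e hc he P pP IP|a c hc P pP IP].
- by rewrite mul0r.
- by rewrite mulrDl; case: (pP) => _ PD _ _ _; exact: PD (hc _ pP IP) (he _ pP IP).
- by rewrite -mulrA; case: (pP) => _ _ PM _ _; exact: PM _ _ (hc _ pP IP).
Qed.

(** The Krull boundary ideal (x) + (rad I : x): its zeros are the boundary in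
    Spec A/I of the zeros of x. *)
Definition boundary I x : set A := adjoin1 (colon_rad I x) x.

Lemma boundary_ideal I x : is_ideal (boundary I x).
Proof. exact/adjoin_ideal/colon_rad_ideal. Qed.

(** Since x belongs to P, a prime Q inside P that omits x is what is needed.  One
    exists unless some s outside P has s x nilpotent modulo I; but such an s
    belongs to (rad I : x), hence to P. *)
Lemma prime_below_boundary I x P : is_ideal I -> prime_ideal P ->
  boundary I x `<=` P ->
  exists Q, [/\ prime_ideal Q, I `<=` Q & Q `<` P].
Proof.
move=> idI pP bP; have [P0 _ _ P1 PM] := pP.
have Px : P x.
  apply: bP; apply: (adjoin_gen (fun=> x) (ord0 : 'I_1)).
  by case: (colon_rad_ideal I x).
have [|||Q [pQ IQ QU]] :=
  @prime_avoiding I [set z | exists s k, ~ P s /\ z = s * x ^+ k] idI.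
- by exists 1, 0%N; rewrite mul1r.
- move=> _ _ [s [k [Ps ->]]] [t [l [Pt ->]]]; exists (s * t), (k + l)%N.
  by split; [move=> /PM[]|rewrite exprD; ring].
- move=> z Iz [s [k [Ps zE]]]; apply: Ps; apply: bP; apply: sub_adjoin.
  move=> P' pP' IP'; have [_ _ PM' _ PX'] := pP'.
  have := IP' _ Iz; rewrite zE => /PX'[|/(prime_exp pP')] h.
    by rewrite mulrC; apply: PM'.
  exact: PM'.
exists Q; split=> //; split=> [y Qy|PQ].
  apply: contrapT => Py; apply: (QU y Qy); exists y, 0%N.
  by rewrite mulr1.
by apply: (QU x (PQ _ Px)); exists 1, 1%N; rewrite mul1r.
Qed.

Lemma dim_lt_boundary I n x :
  is_ideal I -> dim_lt I n.+1 -> dim_lt (boundary I x) n.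
Proof.
move=> idI dI m P pP sP.
have [Q [pQ IQ QP]] := prime_below_boundary idI (pP ord0).1 (pP ord0).2.
have QPi i : Q `<` P i.
  have [->//|i0] := eqVneq i ord0.
  have [P0i _] : P ord0 `<` P i by apply: sP; rewrite lt0n.
  case: QP => QP PQ; split=> [|PiQ]; first exact: subset_trans P0i.
  by apply: PQ; apply: subset_trans PiQ.
have sub i : I `<=` P i by apply: subset_trans IQ _; case: (QPi i).
(* Q put in front of the chain makes it one step longer. *)
rewrite -ltnS.
apply: (dI m.+1 (fun i => if unlift ord0 i is Some j then P j else Q)).
  by move=> i; case: unliftP => // j _; split=> //; case: (pP j).
move=> i j; case: unliftP => [i' ->|->]; case: unliftP => [j' ->|->] //=.
by move=> h; apply: sP.
Qed.

(** Kronecker's theorem, relative to a: some X puts a in the radical of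
    I + (L_i + a X_i).  Put x = L_0.  Modulo the boundary ideal of x, the other n
    entries suffice, so a^k = c + y x + ... with c x in rad I.  Then X_0 = c
    works: at a prime containing c x and x + a c, either x and c both vanish, or a
    does. *)
Lemma kronecker n I a (L : 'I_n -> A) : is_ideal I -> dim_lt I n ->
  exists X : 'I_n -> A, forall P, prime_ideal P -> I `<=` P ->
    (forall i, P (L i + a * X i)) -> P a.
Proof.
elim: n I L => [|n IH] I L idI dI.
  exists (fun=> 0) => P pP IP _.
  suff : (0 < 0)%N by [].
  by apply: (dI 0%N (fun=> P)) => // i j; rewrite !ord1.
set x := L ord0.
have [X hX] := IH _ (fun i => L (lift ord0 i)) (boundary_ideal I x)
                  (dim_lt_boundary (x := x) idI dI).
pose w i := L (lift ord0 i) + a * X i.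
pose K := adjoin (boundary I x) w.
have idK : is_ideal K by exact/adjoin_ideal/boundary_ideal.
have [k [b [u [/adjoin1P[c [y [hc ->]]] akE]]]] : exists k, K (a ^+ k).
  apply: contrapT => /forallNP Ka.
  have [P [pP KP Pa]] := prime_avoiding_exp idK Ka.
  apply: Pa; apply: hX => // [z bz|i]; apply: KP; first exact: sub_adjoin.
  by apply: adjoin_gen; case: (boundary_ideal I x).
exists (fun i => if unlift ord0 i is Some j then X j else c) => P pP IP hP.
have [P0 PD PM P1 PX] := pP.
have Pw i : P (w i) by have := hP (lift ord0 i); rewrite liftK.
have Pxc : P (x + a * c) by have := hP ord0; rewrite unlift_none.
have [Pa|Pcx] : P a \/ (P c /\ P x); [|by []|].
  have [Pc|Px] := PX _ _ (hc P pP IP).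
    right; split=> //; apply: ideal_subD Pxc; first exact: prime_is_ideal.
    exact: PM.
  have /PX[Pa|Pc] : P (a * c); [|by left|by right].
  by apply: (ideal_subD (prime_is_ideal pP) Px); rewrite addrC.
apply: (prime_exp (k := k)) => //; rewrite akE; case: Pcx => Pc Px.
apply: (PD); first by apply: PD => //; apply: PM.
by apply: ideal_sum => [|i]; [apply: prime_is_ideal|apply: PM].
Qed.
End Ideals.

(** * Minors of a perturbation of low rank *)
Section Minors.
Variables (A : comPzRingType) (S : set A).
Hypothesis idS : is_ideal S.

Lemma row'_col'_mxsub p q N (M : 'M[A]_(p, q)) (f : 'I_N -> 'I_p)
    (g : 'I_N -> 'I_q) i j :
  row' i (col' j (mxsub f g M)) = mxsub (f \o lift i) (g \o lift j) M.
Proof. by apply/matrixP => a b; rewrite !mxE. Qed.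

(** Laplace expansion along a bad column or a bad row removes it at the cost of
    one unit of size, so a minor with at most N - n bad rows and columns is a
    combination of n x n minors free of them. *)
Lemma minor_in_ideal p q (M : 'M[A]_(p, q)) (br : pred 'I_p) (bc : pred 'I_q) n :
  (forall (f : 'I_n -> 'I_p) (g : 'I_n -> 'I_q),
     (forall a, ~~ br (f a)) -> (forall b, ~~ bc (g b)) ->
     S (\det (mxsub f g M))) ->
  forall N (f : 'I_N -> 'I_p) (g : 'I_N -> 'I_q),
    (n + \sum_(a < N) br (f a) + \sum_(b < N) bc (g b) <= N)%N ->
    S (\det (mxsub f g M)).
Proof.
have [S0 SD SM] := idS; move=> good; elim=> [|N IH] f g leN.
  move: f g leN => f g; rewrite !big_ord0 !addn0 leqn0 => /eqP n0.
  move: good; rewrite n0 => good.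
  by apply: good; case.
have [nN|ltnN] := eqVneq n N.+1.
  move: good leN; rewrite nN -addnA -[leqRHS]addn0 leq_add2l leqn0 addn_eq0.
  move=> good /andP[/eqP fr0 /eqP gc0]; apply: good => a; apply/negP => bad.
    by move: fr0; rewrite (bigD1 a) //= bad.
  by move: gc0; rewrite (bigD1 a) //= bad.
have {}leN : (n <= N)%N /\
    (n + \sum_(a < N.+1) br (f a) + \sum_(b < N.+1) bc (g b) <= N.+1)%N.
  by split=> //; lia.
case: leN => lenN leN.
have [[j badj]|nobad] := pselect (exists j, bc (g j)).
  rewrite (expand_det_col _ j); apply: ideal_sum => // i; apply: (SM).
  rewrite /cofactor; apply: SM; rewrite row'_col'_mxsub; apply: IH.
  move: leN; rewrite [X in (_ + X + _)%N](@bigD1_ord _ _ _ _ i) //=.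
  by rewrite [X in (_ + X)%N](@bigD1_ord _ _ _ _ j) //= badj; lia.
have gc0 j : bc (g j) = false by apply/negP => bad; apply: nobad; exists j.
have [i [badi|nobadi]] : exists i, br (f i) \/ forall a, br (f a) = false.
  have [[i badi]|nobadi] := pselect (exists i, br (f i)); first by exists i; left.
  by exists ord0; right=> a; apply/negP => bad; apply: nobadi; exists a.
all: rewrite (expand_det_row _ i); apply: ideal_sum => // j; apply: (SM).
all: rewrite /cofactor; apply: SM; rewrite row'_col'_mxsub; apply: IH.
  rewrite [X in (_ + X)%N]big1 => [|b _]; last by rewrite /= gc0.
  by move: leN; rewrite [X in (_ + X + _)%N](@bigD1_ord _ _ _ _ i) //= badi; lia.
by rewrite !big1 ?addn0 // => a _ /=; rewrite ?gc0 ?nobadi.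
Qed.

(** det (G + Q P) is the determinant of the block matrix [1, -P; Q, G], which
    becomes a submatrix of G once its first r rows and r columns are removed. *)
Lemma det_add_low_rank m r n (Q : 'M[A]_(m, r)) (P : 'M[A]_(r, m))
    (G : 'M[A]_m) :
  (n + r <= m)%N ->
  (forall f g : 'I_n -> 'I_m, S (\det (mxsub f g G))) ->
  S (\det (G + Q *m P)).
Proof.
move=> nrm SG; pose H := block_mx 1%:M (- P) Q G.
(* Clearing Q from the first column leaves a block triangular matrix. *)
have detH : \det H = \det (G + Q *m P).
  have -> : H = block_mx 1%:M 0 Q 1%:M *m block_mx 1%:M (- P) 0 (G + Q *m P).
    rewrite mulmx_block !mul1mx !mul0mx !mulmx1 !addr0.
    by rewrite mulmxN addrC addrK.
  by rewrite det_mulmx det_lblock det_ublock !det1 !mul1r.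
rewrite -detH -[H]mxsub_id.
have bad : (\sum_(a < r + m) (a < r)%N = r)%N.
  rewrite big_split_ord /= [X in (_ + X)%N]big1 => [|i _]; last first.
    by rewrite ltnNge leq_addr.
  rewrite addn0 -[RHS]card_ord -sum1_card; apply: eq_bigr => i _.
  by rewrite ltn_ord.
apply: (@minor_in_ideal _ _ H (fun a => a < r)%N (fun a => a < r)%N n); last first.
  by rewrite !bad; lia.
move=> f g rf rg.
have shift (h : 'I_n -> 'I_(r + m)) : (forall a, ~~ (h a < r)%N) ->
    exists h' : 'I_n -> 'I_m, forall a, h a = rshift r (h' a).
  move=> rh; have [a|h' hE] := @choice _ _ (fun a i => h a = rshift r i).
    by case: (split_ordP (h a)) (rh a) => i ->; [|exists i].
  by exists h'.
have [f' fE] := shift f rf; have [g' gE] := shift g rg.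
rewrite (_ : mxsub f g H = mxsub f' g' G) //.
by apply/matrixP => a b; rewrite [LHS]mxE [RHS]mxE fE gE block_mxEdr.
Qed.

End Minors.

(** * The annihilator *)

(** A prime P above I is carried to the quotient as its preimage under the
    section [quot_repr]; since I is contained in P, the choice of
    representatives does not matter. *)
Lemma krull_dim_dim_lt (A : comPzRingType) (I : ideal A) d :
  krull_dim_le (quotient_ring I) d -> dim_lt [set x | x \in I] d.+1.
Proof.
move=> dimI m P pP sP; rewrite ltnS.
pose P' i : set (quotient_ring I) := [set y | P i (quot_repr y)].
have P'E i x : P' i (quot_proj I x) <-> P i x.
  have [pPi IP] := pP i; have idP := prime_is_ideal pPi.
  have /IP Px : x - quot_repr (quot_proj I x) \in I.
    by apply/quot_eqP; rewrite quot_reprK.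
  split=> h; last by apply: (ideal_subD idP Px); rewrite addrC subrK.
  by case: idP => _ PD _; rewrite -[x](subrK (quot_repr (quot_proj I x))); apply: PD.
apply: (dimI m P') => [i|i j /sP[sub nsub]].
  have [[P0 PD PM P1 PX] _] := pP i; split.
  - by rewrite -(rmorph0 (quot_proj I)); apply/P'E.
  - elim/quot_ind=> x; elim/quot_ind=> y /P'E Px /P'E Py.
    by rewrite -rmorphD; apply/P'E/PD.
  - elim/quot_ind=> a; elim/quot_ind=> x /P'E Px.
    by rewrite -rmorphM; apply/P'E/PM.
  - by rewrite -(rmorph1 (quot_proj I)) => /P'E.
  - elim/quot_ind=> x; elim/quot_ind=> y; rewrite -rmorphM => /P'E/PX[] h.
      by left; apply/P'E.
    by right; apply/P'E.
split=> [y|h]; first exact: sub.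
by apply: nsub => x Px; apply/P'E/h/P'E.
Qed.

(** * Making one generator redundant *)
Section Elimination.
Variables (A : comPzRingType) (M : lmodType A) (k : nat) (g : 'I_k.+1 -> M).
Implicit Types (t : 'I_k -> A) (a : 'I_k.+1 -> A) (P : set A) (x y : A).

Let J : set A := [set x | x \in annihilator M].

Lemma annihilator_is_ideal : is_ideal J.
Proof.
split=> [|x y|a x]; [exact: rpred0|exact: rpredD|exact: annihilator_absorbing].
Qed.

Definition relation a : Prop := \sum_i a i *: g i = 0.

(** The coefficient of g_0 when the combination of the g_i with coefficients a is
    rewritten in the generators g_0 and g_i - t_i g_0. *)
Definition coef0 t a : A := a ord0 + \sum_(i < k) t i * a (lift ord0 i).

Lemma relation_coef0 t a : relation a ->
  coef0 t a *: g ord0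
    + \sum_(i < k) a (lift ord0 i) *: (g (lift ord0 i) - t i *: g ord0) = 0.
Proof.
rewrite /relation big_ord_recl => ra; rewrite -[RHS]ra.
rewrite scalerDl -addrA; congr (_ + _); rewrite scaler_suml -big_split /=.
by apply: eq_bigr => i _; rewrite scalerBr !scalerA [t i * _]mulrC addrC subrK.
Qed.

Lemma relationD a b : relation a -> relation b -> relation (fun i => a i + b i).
Proof.
move=> ra rb; rewrite /relation; under eq_bigr do rewrite scalerDl.
by rewrite big_split /= ra rb addr0.
Qed.

Lemma relationM c a : relation a -> relation (fun i => c * a i).
Proof.
move=> ra; rewrite /relation; under eq_bigr do rewrite -scalerA.
by rewrite -scaler_sumr ra scaler0.
Qed.

Lemma coef0_ideal t : is_ideal [set x | exists a, relation a /\ x = coef0 t a].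
Proof.
split.
- exists (fun=> 0); split; first by apply: big1 => i _; rewrite scale0r.
  by rewrite /coef0 big1 ?addr0 // => i _; rewrite mulr0.
- move=> _ _ [a [ra ->]] [b [rb ->]].
  exists (fun i => a i + b i); split; first exact: relationD.
  rewrite /coef0 addrACA -big_split /=; congr (_ + _).
  by apply: eq_bigr => i _; rewrite mulrDr.
- move=> c _ [a [ra ->]]; exists (fun i => c * a i); split; first exact: relationM.
  rewrite /coef0 mulrDr mulr_sumr; congr (_ + _).
  by apply: eq_bigr => i _; rewrite mulrCA.
Qed.

(** The closed set V(D_t) of Spec A, where D_t is the ideal of [coef0_ideal]. *)
Definition zeros t : set (set A) :=
  [set P | prime_ideal P /\ forall a, relation a -> P (coef0 t a)].

(** An element x of the annihilator is the coefficient of the relation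
    x g_0 = 0. *)
Lemma zeros_annihilator t P : zeros t P -> J `<=` P.
Proof.
case=> _ hP x /asboolP xM.
have := hP (fun i => if i == ord0 then x else 0); rewrite /coef0 eqxx.
rewrite big1 ?addr0 => [|i _]; last by rewrite mulr0.
by apply; rewrite /relation big_ord_recl xM add0r big1 // => i _; rewrite scale0r.
Qed.

(** Starting from any t with rad D_t containing D_0, one can change t so that
    rad D_t grows and acquires x.  Quantifying over all such t is what makes the
    absorbed elements closed under addition: absorb one summand, then the
    other. *)
Definition absorbed x : Prop :=
  forall t, zeros t `<=` zeros (fun=> 0) ->
    exists t', zeros t' `<=` zeros t /\ forall P, zeros t' P -> P x.

Lemma absorbed_ideal : is_ideal absorbed.
Proof.
split=> [t _|x y hx hy t t0|a x hx t t0].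
- by exists t; split=> // P [[]].
- have [t1 [t1t P1]] := hx t t0.
  have [t2 [t2t1 P2]] := hy t1 (subset_trans t1t t0).
  exists t2; split=> [|P zP]; first exact: subset_trans t1t.
  have [[_ PD _ _ _] _] := zP.
  exact: PD (P1 _ (t2t1 _ zP)) (P2 _ zP).
- have [t1 [t1t P1]] := hx t t0; exists t1; split=> // P zP.
  have [[_ _ PM _ _] _] := zP.
  exact: PM _ _ (P1 _ zP).
Qed.

Lemma absorbed_exp x e : absorbed (x ^+ e) -> absorbed x.
Proof.
move=> hx t t0; have [t1 [t1t P1]] := hx t t0; exists t1; split=> // P zP.
by apply: (@prime_exp _ _ _ e); [case: zP|apply: P1].
Qed.

Lemma absorbed_coord0 a : relation a -> absorbed (a ord0).
Proof.
move=> ra t t0; exists t; split=> // P /t0[_ /(_ a ra)].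
by rewrite /coef0 big1 ?addr0 // => i _; rewrite mul0r.
Qed.

(** If the minor involves coordinate 0, expand it along that column; otherwise
    apply [kronecker] to a = delta^2 and the coefficients of the n relations. *)
Lemma absorbed_minor n q (R : 'M[A]_(q, k.+1)) (f : 'I_n -> 'I_q)
    (h : 'I_n -> 'I_k.+1) :
  dim_lt J n -> (forall i, relation (R i)) -> absorbed (\det (mxsub f h R)).
Proof.
move=> dimJ relR; set D := mxsub f h R; set delta := \det D.
have [[j hj]|h0] := pselect (exists j, h j = ord0).
  rewrite /delta (expand_det_col _ j); refine (ideal_sum absorbed_ideal _) => i.
  have [_ _ mulS] := absorbed_ideal.
  by rewrite mulrC; apply: mulS; rewrite mxE hj; apply: absorbed_coord0.
have [j|h' h'E] := @choice _ _ (fun j i => h j = lift ord0 i).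
  by case: (unliftP ord0 (h j)) => [i ->|hj]; [exists i|case: h0; exists j].
move=> t _; pose c i := coef0 t (R (f i)).
have [X hX] := kronecker (delta ^+ 2) c annihilator_is_ideal dimJ.
(* The change t' - t is the vector delta * adj D * X, carried from the columns
   of D to the coordinates by h'; the sum over a fibre covers a repeated
   column. *)
pose z b := \sum_i (\adj D) b i * X i.
pose t' i := t i + \sum_(b | h' b == i) delta * z b.
have coefE a : coef0 t' a = coef0 t a + delta * \sum_b z b * a (h b).
  rewrite /coef0 -addrA; congr (_ + _).
  under eq_bigr do rewrite mulrDl.
  rewrite big_split /=; congr (_ + _).
  rewrite mulr_sumr [RHS](partition_big h' predT) //=; apply: eq_bigr => i _.
  rewrite mulr_suml; apply: eq_bigr => b /eqP <-.
  by rewrite h'E mulrA.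
have coefR i : coef0 t' (R (f i)) = c i + delta ^+ 2 * X i.
  rewrite coefE; congr (_ + _); rewrite expr2 -mulrA; congr (_ * _).
  have <- : (D *m (\adj D *m \col_j X j)) i ord0 = delta * X i.
    by rewrite mulmxA mul_mx_adj mul_scalar_mx !mxE.
  rewrite mxE; apply: eq_bigr => b _; rewrite mulrC; congr (_ * _).
    by rewrite /D mxE.
  by rewrite mxE; apply: eq_bigr => j _; rewrite [X in _ = _ * X]mxE.
have Pdelta P : zeros t' P -> P delta.
  move=> zP; have [pP hP] := zP.
  apply: (@prime_exp _ _ _ 2) => //; apply: (hX P pP (zeros_annihilator zP)) => i.
  by rewrite -coefR; apply: hP.
(* Where delta vanishes, the coefficients for t and t' agree. *)
exists t'; split=> // P zP; have [pP hP] := zP; split=> // a ra.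
have idP := prime_is_ideal pP; have := hP a ra; rewrite coefE.
apply: (ideal_subD idP); have [_ _ PM] := idP.
by rewrite mulrC; exact: PM _ _ (Pdelta _ zP).
Qed.

End Elimination.

(** * Relations from local generators *)
Section LocalGenerators.
Variables (A : comPzRingType) (M : lmodType A) (s : A) (r : nat).

(** Numerators of generators of the localization generate M up to powers of
    s. *)
Lemma local_numerators :
  @generated_by (localization_ring s) (localization s M) r ->
  exists w : 'I_r -> M, forall m, exists N (q : 'I_r -> A),
    s ^+ N *: m = \sum_j q j *: w j.
Proof.
case=> v gen; exists (fun j => lfrac_num (v j)) => m.
pose comb (x : localization s M) := exists N (q : 'I_r -> A),
  x = lfrac s (\sum_j q j *: lfrac_num (v j)) N.
suff [N [q /lfrac_eqP[e mE]]] : comb (lfrac s m 0).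
  exists (e + N)%N, (fun j => s ^+ e * q j); rewrite mE addn0 scaler_sumr.
  by apply: eq_bigr => j _; rewrite scalerA.
have [c ->] := gen (lfrac s m 0).
elim/big_ind: _ => [|_ _ [N [q ->]] [N' [q' ->]]|j _].
- exists 0%N, (fun=> 0); rewrite big1 // => j _; exact: scale0r.
- exists (N + N')%N, (fun j => s ^+ N' * q j + s ^+ N * q' j).
  rewrite lfracD; congr (lfrac _ _ _); rewrite !scaler_sumr -big_split /=.
  by apply: eq_bigr => j _; rewrite scalerDl !scalerA.
- elim/ring_fracW: (c j) => a i.
  exists (i + lfrac_exp (v j))%N, (fun l => a *+ (l == j)).
  rewrite (bigD1 j) //= eqxx big1 ?addr0 => [|l /negPf ->]; last exact: scale0r.
  by rewrite -[v j in LHS]lfracK; apply: loc_scaleE.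
Qed.

(** Q expresses s^N g in the r numerators w, and P expresses w in g. *)
Lemma local_relations m (g : 'I_m -> M) :
  (forall x, exists c : 'I_m -> A, x = \sum_i c i *: g i) ->
  @generated_by (localization_ring s) (localization s M) r ->
  exists N (Q : 'M[A]_(m, r)) (P : 'M[A]_(r, m)), forall i,
    \sum_j ((s ^+ N)%:M - Q *m P) i j *: g j = 0.
Proof.
move=> gen /local_numerators[w hw].
have [l|p wE] := @choice _ _ (fun l p => w l = \sum_(j < m) p j *: g j).
  exact: gen.
have [i|e qE] := @choice _ _ (fun (i : 'I_m) (e : nat * ('I_r -> A)) =>
  s ^+ e.1 *: g i = \sum_l e.2 l *: w l).
  by have [N [q h]] := hw (g i); exists (N, q).
(* A common exponent: the sum bounds every one of them. *)
pose N := \sum_i (e i).1.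
exists N, (\matrix_(i, l) (s ^+ (N - (e i).1) * (e i).2 l)), (\matrix_(l, j) p l j).
move=> i; under eq_bigr do rewrite !mxE scalerBl.
rewrite sumrB (bigD1 i) //= eqxx mulr1n [X in _ + X - _]big1 ?addr0; last first.
  by move=> j /negPf; rewrite eq_sym => ->; rewrite mulr0n scale0r.
have eN : ((e i).1 <= N)%N by rewrite /N (bigD1 i) //= leq_addr.
rewrite -{1}(subnK eN) exprD -scalerA qE.
apply/eqP; rewrite subr_eq0; apply/eqP.
under [RHS]eq_bigr do rewrite scaler_suml.
rewrite exchange_big scaler_sumr /=; apply: eq_bigr => l _.
rewrite wE !scaler_sumr; apply: eq_bigr => j _.
by rewrite !mxE !scalerA.
Qed.

End LocalGenerators.

(** * Descent on the number of generators *)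

(** A power of each s_i is det (G + Q P) for a matrix G of relations, so each
    s_i is absorbed, and then so is 1.  The resulting t has no zeros, hence
    1 = coef0 t a for a relation a, which expresses g_0 in the other
    generators. *)
Lemma drop_generator (A : comPzRingType) (M : lmodType A) (r n k : nat) :
  dim_lt [set x | x \in annihilator M] n -> locally_generated_by M r ->
  (n + r <= k.+1)%N -> generated_by M k.+1 -> generated_by M k.
Proof.
move=> dimJ [q [s [[c cE] locs]]] nrk [g gen].
have idS := absorbed_ideal g.
have Ss i : absorbed g (s i).
  have [N [Q [P rel]]] := local_relations gen (locs i).
  apply: (@absorbed_exp _ _ _ _ _ (N * k.+1)).
  (* (s^N)^(k + 1) is the determinant of the scalar matrix s^N. *)
  rewrite exprM -det_scalar -[_%:M](subrK (Q *m P)).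
  by apply: (det_add_low_rank idS Q P nrk) => f h; apply: absorbed_minor.
have S1 : absorbed g 1.
  by rewrite -cE; refine (ideal_sum idS _) => i; case: idS => _ _; apply.
have [t [_ noP]] := S1 (fun=> 0) (@subset_refl _ _).
have [a [ra aE]] : exists a, relation g a /\ 1 = coef0 t a.
  apply: (ideal_unit (coef0_ideal g t)) => P pP IP.
  have [_ _ _ P1 _] := pP; apply: P1; apply: (noP P); split=> // a ra.
  by apply: IP; exists a.
pose h i := g (lift ord0 i) - t i *: g ord0.
have g0E : g ord0 = \sum_(i < k) - a (lift ord0 i) *: h i.
  have := relation_coef0 t ra; rewrite -aE scale1r => /eqP.
  by rewrite addr_eq0 -sumrN => /eqP ->; apply: eq_bigr => i _; rewrite scaleNr.
exists h => x; have [b ->] := gen x.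
exists (fun i => b (lift ord0 i) + coef0 t b * - a (lift ord0 i)).
under [RHS]eq_bigr do rewrite scalerDl -scalerA.
rewrite big_split /= -scaler_sumr -g0E big_ord_recl /coef0 scalerDl.
rewrite addrCA; congr (_ + _); rewrite scaler_suml -big_split /=.
by apply: eq_bigr => i _; rewrite scalerBr !scalerA [t i * _]mulrC subrK.
Qed.

Lemma generated_byW (R : pzRingType) (V : lmodType R) m n :
  (m <= n)%N -> generated_by V m -> generated_by V n.
Proof.
move=> /subnKC <- [v gen].
exists (fun i => if split i is inl j then v j else 0) => x.
have [c ->] := gen x.
exists (fun i => if split i is inl j then c j else 0).
rewrite big_split_ord /= [X in _ + X]big1 ?addr0 => [|i _].
  by apply: eq_bigr => i _; have /= -> := unsplitK (inl i : 'I_m + 'I_(n - m)).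
by have /= -> := unsplitK (inr i : 'I_m + 'I_(n - m)); rewrite scale0r.
Qed.

Theorem mainTheorem9 (A : comPzRingType) (d r : nat) (M : lmodType A) :
  finitely_generated M ->
  krull_dim_le (quotient_ring (annihilator M)) d ->
  locally_generated_by M r ->
  generated_by M (d + r)%N.
Proof.
move=> [m genM] /krull_dim_dim_lt dimJ locM.
elim: m genM => [|k IH] genM; first exact: generated_byW genM.
have [le|gt] := leqP k.+1 (d + r); first exact: generated_byW genM.
apply/IH/(@drop_generator _ _ r (k.+1 - r)) => //; last by lia.
by apply: dim_ltW dimJ; lia.
Qed.
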